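(* Let $A$ be as in the context. If $A$ is normal and $d\le 3$, then there exists a generic cost vector $c\in\mathbb Z^n$ such that $IP_{A,c}$ is a Gomory family.
   Context: $A\in\mathbb Z^{d\times n}$ has rank $d$, columns $a_1,\dots,a_n$, $cone(A)$ pointed, $\{x\in\mathbb R^n_{\ge0}:Ax=0\}=\{0\}$, $\mathbb ZA=\mathbb Z^d$, $\mathbb NA=\{Au:u\in\mathbb N^n\}$. $A$ is normal if $\mathbb NA=cone(A)\cap\mathbb Z^d$. For $c\in\mathbb R^n$, $\Delta_c$ is the collection of $\sigma\subseteq\{1,\dots,n\}$ for which some $y\in\mathbb R^d$ has $y\cdot a_j=c_j$ ($j\in\sigma$), $y\cdot a_j<c_j$ ($j\notin\sigma$). A cost vector $c$ is generic if $\Delta_c$ is a triangulation of $cone(A)$ and every program $IP_{A,c}(b)=\min\{c\cdot x: Ax=b,\ x\in\mathbb N^n\}$, $b\in\mathbb NA$, has a unique optimal solution; $IP_{A,c}$ is the family of these programs. For a maximal face $\sigma$ of $\Delta_c$ let $\tilde c_{\bar\sigma}=c_{\bar\sigma}-c_\sigma A_\sigma^{-1}A_{\bar\sigma}$; the group relaxation $G^\sigma(b)$ is $\min\{\tilde c_{\bar\sigma}\cdot x_{\bar\sigma}: A_\sigma x_\sigma+A_{\bar\sigma}x_{\bar\sigma}=b,\ x_{\bar\sigma}\ge0,\ x\in\mathbb Z^n\}$, which solves $IP_{A,c}(b)$ if its optimal solution is non-negative. $IP_{A,c}$ is a Gomory family if for every $b\in\mathbb NA$ some maximal face $\sigma$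 of $\Delta_c$ has $G^\sigma(b)$ solving $IP_{A,c}(b)$. *)

(* Defs.v *)
From HB Require Import structures.
From mathcomp Require Import all_boot all_order all_algebra.
From mathcomp Require Import Rstruct.
From Stdlib Require Rdefinitions.

Set Implicit Arguments.
Unset Strict Implicit.
Unset Printing Implicit Defensive.

Import Order.TTheory GRing.Theory Num.Theory.
Local Open Scope ring_scope.

Notation RR := Rdefinitions.R.

Section GomoryDefs.
Variables (d n : nat) (A : 'M[int]_(d, n)).

Definition AR : 'M[RR]_(d, n) := map_mx (fun z : int => z%:~R) A.

Definition in_cone_sub (sigma : {set 'I_n}) (v : 'cV[RR]_d) : Prop :=
  exists x : 'cV[RR]_n,
    (forall j, 0 <= x j 0) /\ (forall j, j \notin sigma -> x j 0 = 0) /\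
    AR *m x = v.

Definition in_cone (v : 'cV[RR]_d) : Prop := in_cone_sub setT v.

Definition in_NA (b : 'cV[int]_d) : Prop :=
  exists u : 'cV[int]_n, (forall j, 0 <= u j 0) /\ A *m u = b.

Definition full_rank : Prop := \rank AR = d.
Definition cone_pointed : Prop :=
  forall v : 'cV[RR]_d, in_cone v -> in_cone (- v) -> v = 0.
Definition kernel_pos_trivial : Prop :=
  forall x : 'cV[RR]_n, (forall j, 0 <= x j 0) -> AR *m x = 0 -> x = 0.
Definition lattice_full : Prop :=
  forall b : 'cV[int]_d, exists u : 'cV[int]_n, A *m u = b.

Definition standing_assumptions : Prop :=
  [/\ full_rank, cone_pointed, kernel_pos_trivial & lattice_full].

Definition normal : Prop :=
  forall b : 'cV[int]_d, in_NA b <-> in_cone (map_mx (fun z : int => z%:~R) b).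

Variable c : 'rV[int]_n.

Definition cR : 'rV[RR]_n := map_mx (fun z : int => z%:~R) c.

Definition in_Delta (sigma : {set 'I_n}) : Prop :=
  exists y : 'rV[RR]_d,
    forall j : 'I_n,
      (j \in sigma -> (y *m col j AR) 0 0 = cR 0 j) /\
      (j \notin sigma -> (y *m col j AR) 0 0 < cR 0 j).

Definition triangulation (Delta : {set 'I_n} -> Prop) : Prop :=
  [/\ (forall sigma, Delta sigma ->
         forall x : 'cV[RR]_n, (forall j, j \notin sigma -> x j 0 = 0) ->
           AR *m x = 0 -> x = 0),
      (forall sigma (tau : {set 'I_n}), Delta sigma -> tau \subset sigma -> Delta tau),
      (forall v, in_cone v -> exists2 sigma, Delta sigma & in_cone_sub sigma v)
    & (forall sigma tau, Delta sigma -> Delta tau -> forall v,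
         in_cone_sub sigma v -> in_cone_sub tau v ->
         in_cone_sub (sigma :&: tau) v)].

Definition cost (x : 'cV[int]_n) : RR := (cR *m map_mx (fun z : int => z%:~R) x) 0 0.

Definition IP_feasible (b : 'cV[int]_d) (x : 'cV[int]_n) : Prop :=
  (forall j, 0 <= x j 0) /\ A *m x = b.

Definition IP_optimal (b : 'cV[int]_d) (x : 'cV[int]_n) : Prop :=
  IP_feasible b x /\ forall x', IP_feasible b x' -> cost x <= cost x'.

Definition unique_optimum (b : 'cV[int]_d) : Prop :=
  exists x, IP_optimal b x /\ forall x', IP_optimal b x' -> x' = x.

Definition generic : Prop :=
  triangulation in_Delta /\ forall b, in_NA b -> unique_optimum b.

Definition maximal_face (sigma : {set 'I_n}) : Prop :=
  in_Delta sigma /\ forall tau, in_Delta tau -> sigma \subset tau -> tau = sigma.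

(* A_sigma (columns of A indexed by sigma, in increasing order) and c_sigma;
   for a maximal face #|sigma| = d, and conform_mx turns them into a square
   d x d matrix and a row of length d respectively. *)
Definition A_sub (sigma : {set 'I_n}) : 'M[RR]_(d, #|sigma|) :=
  \matrix_(i < d, k < #|sigma|) AR i (enum_val k).
Definition c_sub (sigma : {set 'I_n}) : 'rV[RR]_#|sigma| :=
  \row_(k < #|sigma|) cR 0 (enum_val k).

Definition dual_sol (sigma : {set 'I_n}) : 'rV[RR]_d :=
  conform_mx (0 : 'rV[RR]_d) (c_sub sigma) *m
  invmx (conform_mx (0 : 'M[RR]_d) (A_sub sigma)).

Definition red_cost (sigma : {set 'I_n}) (j : 'I_n) : RR :=
  cR 0 j - (dual_sol sigma *m col j AR) 0 0.

Definition group_obj (sigma : {set 'I_n}) (x : 'cV[int]_n) : RR :=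
  \sum_(j in ~: sigma) red_cost sigma j * (x j 0)%:~R.

Definition group_feasible (sigma : {set 'I_n}) (b : 'cV[int]_d)
    (x : 'cV[int]_n) : Prop :=
  (forall j, j \notin sigma -> 0 <= x j 0) /\ A *m x = b.

Definition group_optimal (sigma : {set 'I_n}) (b : 'cV[int]_d)
    (x : 'cV[int]_n) : Prop :=
  group_feasible sigma b x /\
  forall x', group_feasible sigma b x' -> group_obj sigma x <= group_obj sigma x'.

Definition group_solves (sigma : {set 'I_n}) (b : 'cV[int]_d) : Prop :=
  exists x, group_optimal sigma b x /\ forall j, 0 <= x j 0.

Definition gomory_family : Prop :=
  forall b, in_NA b -> exists sigma, maximal_face sigma /\ group_solves sigma b.

End GomoryDefs.

(* Main.v *)
Require Import Defs.
From HB Require Import structures.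
From mathcomp Require Import all_boot all_order all_algebra.
From mathcomp Require Import Rstruct.
From mathcomp Require Import lra ring polyrcf.

(** If the regular triangulation Delta_c is unimodular, then for [b] in the
    cone of a maximal face [sigma] the vector [A_sigma^-1 b] is integral and
    non-negative and has reduced cost 0, so it is the unique optimum of
    IP_{A,c}(b) and an optimum (with objective 0) of the group relaxation.  It
    remains to find a regular unimodular triangulation.

    Start from the cost [c_j = - t^(n+1) + |a_j|^2 t^n + t^j] with [t] large.
    On a cell let [h] be the linear functional equal to 1 on its generators.
    The leading term forces [h >= 1] on all columns, hence on all nonzero
    lattice points of cone(A) (normality); the second term, by strict convexity
    of the norm, excludes columns of the cell with [h = 1] other than generators;
    the last term makes [c] generic.  So the simplex spanned by 0 and the generators has
    no other lattice points.  If [z] is a lattice point of the half-open box and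
    [z'] is its complement in the face of the box it spans, then
    [h z + h z' <= d <= 3] and both exceed 1, so [h z < 2] and by normality [z]
    is a column.

    While some cell is not unimodular, subdivide it at the column [p] of its
    half-open box with smallest [h p]; for [d <= 3] such a [p] is interior to
    the cell, so no other cell is affected.  If the box of a new cell contained
    a lattice point [z] outside the old box, then [z - v] for a generator [v]
    and the complement of [z] in the new box would be non-integral points of the old
    cell, whose [h]-values are each at least [h p] and sum to at most
    [1 + h p < 2 h p].  So the set of columns in boxes of cells strictly
    decreases. *)

Set Implicit Arguments.
Unset Strict Implicit.
Unset Printing Implicit Defensive.

Import Order.TTheory GRing.Theory Num.Theory.
Local Open Scope ring_scope.

(** * Preliminaries on matrices and sums *)

Lemma mulmx_sum_col (R : comPzRingType) m n (M : 'M[R]_(m, n)) (x : 'cV_n) :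
  M *m x = \sum_j x j 0 *: col j M.
Proof.
apply/matrixP => r s; rewrite !mxE summxE; apply: eq_bigr => k _.
by rewrite !mxE (ord1 s) mulrC.
Qed.

Lemma sum_codom (V : nmodType) d n (f : 'I_d -> 'I_n) (F : 'I_n -> V) :
  injective f -> (forall j, j \notin codom f -> F j = 0) ->
  \sum_j F j = \sum_k F (f k).
Proof.
move=> fi F0; rewrite (bigID (mem (codom f))) /= [X in _ + X]big1 // addr0.
rewrite -(@big_imset _ _ _ _ _ f predT) /=; last by move=> x y _ _ /fi.
by apply: eq_bigl => j; apply/codomP/imsetP => [[k ->]|[k _ ->]]; exists k.
Qed.

(** For injective [f], the vector with entry [w k] at position [f k] and 0 elsewhere. Summing over
    fibres avoids a partial inverse of [f]. *)
Definition spread (R : nmodType) d n (f : 'I_d -> 'I_n) (w : 'I_d -> R) :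
    'cV[R]_n :=
  \col_j \sum_(k | f k == j) w k.

Lemma mulmx_spread (R : comPzRingType) d m n (M : 'M[R]_(m, n))
    (f : 'I_d -> 'I_n) (w : 'I_d -> R) :
  M *m spread f w = \sum_k w k *: col (f k) M.
Proof.
rewrite mulmx_sum_col (partition_big f predT) //=.
apply: eq_bigr => j _; rewrite mxE scaler_suml.
by apply: eq_bigr => k /eqP->.
Qed.

Lemma spread_notin (R : nmodType) d n (f : 'I_d -> 'I_n) (w : 'I_d -> R) j :
  j \notin codom f -> spread f w j 0 = 0.
Proof.
move=> nj; rewrite mxE big1 // => k /eqP e.
by rewrite -e codom_f in nj.
Qed.

Lemma spread_at (R : nmodType) d n (f : 'I_d -> 'I_n) (w : 'I_d -> R) k :
  injective f -> spread f w (f k) 0 = w k.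
Proof. by move=> fi; rewrite mxE (big_pred1 k) // => l;
  rewrite (inj_eq fi). Qed.

Lemma spread_ge0 (R : numDomainType) d n (f : 'I_d -> 'I_n) (w : 'I_d -> R) j :
  (forall k, 0 <= w k) -> 0 <= spread f w j 0.
Proof. by move=> w0; rewrite mxE sumr_ge0. Qed.

Lemma mul_row_cols (R : comPzRingType) d n (a : 'M[R]_(d, n)) (y : 'rV_d)
    (x : 'cV_n) :
  (y *m (a *m x)) 0 0 = \sum_j x j 0 * (y *m col j a) 0 0.
Proof.
rewrite (mulmx_sum_col a) mulmx_sumr summxE; apply: eq_bigr => j _.
by rewrite -scalemxAr mxE.
Qed.

(** With [conform_row] this opens [dual_sol]: once the sizes agree, [conform_mx] only casts indices
    and its default 0 is never taken. *)
Lemma conform_colsub (R : comPzRingType) m d n (a : 'M[R]_(d, n)) (E : m = d)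
    (h : 'I_m -> 'I_n) :
  conform_mx (0 : 'M[R]_d) (\matrix_(i < d, k < m) a i (h k)) =
  colsub (fun k => h (cast_ord (esym E) k)) a.
Proof.
subst m; rewrite conform_mx_id; apply/matrixP => r s.
by rewrite !mxE; congr (a r (h _)); apply: val_inj.
Qed.

Lemma conform_row (R : comPzRingType) m d (E : m = d) (h : 'I_m -> R) :
  conform_mx (0 : 'rV[R]_d) (\row_k h k) = \row_k h (cast_ord (esym E) k).
Proof.
subst m; rewrite conform_mx_id; apply/rowP => s.
by rewrite !mxE; congr (h _); apply: val_inj.
Qed.

(** Source of all small perturbations: [M^-1] serves as a step size when a cost or a dual vector is
    changed, [M] as the scaling factor before rounding. *)
Lemma large_multiple (R : realFieldType) (I : finType) (P : pred I)
    (x y : I -> R) : (forall i, P i -> 0 < x i) ->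
  exists2 M, 0 < M & forall N, M <= N -> forall i, P i -> y i < N * x i.
Proof.
move=> x0; exists (1 + \sum_(i | P i) `|y i| / x i).
  by rewrite ltr_pwDl ?ltr01 // sumr_ge0 // => i /x0/ltW xi; rewrite divr_ge0.
move=> N MN i Pi; rewrite -ltr_pdivrMr ?x0 //; apply: lt_le_trans MN.
apply: (@le_lt_trans _ _ (`|y i| / x i)).
  by rewrite ler_pM2r ?invr_gt0 ?x0 // ler_norm.
rewrite (bigD1 i) //= addrCA ltrDl ltr_pwDl ?ltr01 // sumr_ge0 //.
move=> l /andP[Pl _].
by rewrite divr_ge0 // ltW ?x0.
Qed.

(** * Bases formed by columns *)

Section Bases.
Variables (R : realFieldType) (d n : nat) (a : 'M[R]_(d, n)).
Implicit Types (f g : {ffun 'I_d -> 'I_n}) (i k : 'I_d) (j : 'I_n).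
Implicit Types (v w : 'cV[R]_d) (c : 'I_n -> R).

(** Generators form an ordered tuple rather than a set, so that the matrix is square without casts;
    invertibility excludes repetitions. *)
Definition basis_mx f : 'M[R]_d := colsub f a.
Definition lam f v k : R := (invmx (basis_mx f) *m v) k 0.
(* The value at [v] of the linear functional equal to [c (f k)] at the [f k]-th
   column: on a maximal face, the dual solution y_sigma applied to [v]. *)
Definition price c f v : R := \sum_k c (f k) * lam f v k.
Definition height f v : R := \sum_k lam f v k.
Definition pivot f i j : {ffun 'I_d -> 'I_n} :=
  [ffun k => if k == i then j else f k].

Lemma lamD f v w k : lam f (v + w) k = lam f v k + lam f w k.
Proof. by rewrite /lam mulmxDr mxE. Qed.

Lemma lamN f v k : lam f (- v) k = - lam f v k.
Proof. by rewrite /lam mulmxN mxE. Qed.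

Lemma lamB f v w k : lam f (v - w) k = lam f v k - lam f w k.
Proof. by rewrite lamD lamN. Qed.

Lemma lam_sum (I : finType) (P : pred I) (x : I -> R) (u : I -> 'cV_d) f k :
  lam f (\sum_(i | P i) x i *: u i) k = \sum_(i | P i) x i * lam f (u i) k.
Proof.
rewrite /lam mulmx_sumr summxE; apply: eq_bigr => i _.
by rewrite -scalemxAr mxE.
Qed.

Lemma lam0 f k : lam f 0 k = 0.
Proof. by rewrite /lam mulmx0 mxE. Qed.

Lemma mul_basis_mx f (w : 'cV[R]_d) :
  basis_mx f *m w = \sum_k w k 0 *: col (f k) a.
Proof.
by rewrite mulmx_sum_col; apply: eq_bigr => k _; rewrite col_colsub.
Qed.

Lemma lamK f v : basis_mx f \in unitmx -> \sum_k lam f v k *: col (f k) a = v.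
Proof. by move=> uf; rewrite -(mul_basis_mx f (invmx (basis_mx f) *m v))
  mulKVmx. Qed.

Lemma lam_uniq f v (w : 'I_d -> R) : basis_mx f \in unitmx ->
  \sum_k w k *: col (f k) a = v -> forall k, lam f v k = w k.
Proof.
move=> uf <- k; have -> : \sum_k w k *: col (f k) a = basis_mx f *m (\col_k w
  k).
  by rewrite mul_basis_mx; apply: eq_bigr => i _; rewrite !mxE.
by rewrite /lam mulKmx // mxE.
Qed.

Lemma lam_col f i k : basis_mx f \in unitmx ->
  lam f (col (f i) a) k = (k == i)%:R.
Proof.
move=> uf; apply: (lam_uniq uf (w := fun k => (k == i)%:R)).
rewrite (bigD1 i) //= eqxx scale1r big1 ?addr0 // => l /negPf->.
by rewrite scale0r.
Qed.

Lemma basis_mx_inj f : basis_mx f \in unitmx -> injective f.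
Proof.
move=> uf i k eik; have := lam_col i k uf.
by rewrite eik lam_col // eqxx; case: eqP => // _ /eqP; rewrite oner_eq0.
Qed.

Lemma price_sum (I : finType) (P : pred I) (x : I -> R) (u : I -> 'cV_d) c f :
  price c f (\sum_(i | P i) x i *: u i) = \sum_(i | P i) x i * price c f (u i).
Proof.
rewrite /price; under eq_bigr do rewrite lam_sum mulr_sumr.
rewrite exchange_big /=; apply: eq_bigr => i _; rewrite mulr_sumr.
by apply: eq_bigr => k _; ring.
Qed.

Lemma price_col c f i : basis_mx f \in unitmx -> price c f (col (f i) a) = c
  (f i).
Proof.
move=> uf; rewrite /price (bigD1 i) //= lam_col // eqxx mulr1 big1 ?addr0 //.
by move=> k /negPf nki; rewrite lam_col // nki mulr0.
Qed.

Lemma heightE f v : height f v = price (fun=> 1) f v.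
Proof. by apply: eq_bigr => k _; rewrite mul1r. Qed.

Section Pivot.
Variables (f : {ffun 'I_d -> 'I_n}) (i : 'I_d) (j : 'I_n).
Hypotheses (uf : basis_mx f \in unitmx) (nz : lam f (col j a) i != 0).
Let mu := lam f (col j a).

(** Coordinates after the exchange, found by solving the expansion of [col j a] for [col (f i) a]
    and substituting. *)
Let piv v k : R := lam f v i / mu i * (k == i)%:R
  + (lam f v k - mu k * (lam f v i / mu i)) * (k != i)%:R.

Let pivE v : \sum_k piv v k *: col (pivot f i j k) a = v.
Proof.
rewrite -[RHS](lamK v uf) (bigD1 i) //= [RHS](bigD1 i) //=.
have ej : col j a = mu i *: col (f i) a + \sum_(k | k != i) mu k *: col (f k) a.
  by rewrite -[LHS](lamK _ uf) (bigD1 i).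
rewrite {1}/piv ffunE eqxx /= mulr1 mulr0 addr0 ej scalerDr scalerA divfK //.
rewrite -addrA; congr (_ + _); rewrite scaler_sumr -big_split /=.
apply: eq_bigr => k nki; rewrite ffunE (negPf nki) scalerA -scalerDl.
by rewrite /piv (negPf nki) /=; congr (_ *: _); ring.
Qed.

Lemma pivot_unit : basis_mx (pivot f i j) \in unitmx.
Proof.
(* The columns of the right inverse are the new coordinates of the unit vectors. *)
have [] // := @mulmx1_unit _ _ (basis_mx (pivot f i j))
  (\matrix_(k, l) piv (delta_mx l 0) k).
apply/matrixP => r s; rewrite mxE.
transitivity ((delta_mx s 0 : 'cV[R]_d) r 0); last first.
  by rewrite !mxE eqxx andbT.
rewrite -[X in _ = fun_of_matrix X _ _]pivE summxE; apply: eq_bigr => k _.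
by rewrite !mxE mulrC.
Qed.

Lemma lam_pivot v k : lam (pivot f i j) v k =
  if k == i then lam f v i / mu i else lam f v k - mu k * (lam f v i / mu i).
Proof.
rewrite (lam_uniq pivot_unit (pivE v)) /piv.
by case: eqP => [->|_] /=; rewrite ?mulr1 ?mulr0 ?addr0 ?add0r.
Qed.

(** The simplex update: reduced cost of the entering column times step length. As an identity in [v]
    it also describes the move of the dual solution. *)
Lemma price_pivot c v : price c (pivot f i j) v =
  price c f v + (c j - price c f (col j a)) * (lam f v i / mu i).
Proof.
rewrite /price (bigD1 i) //= lam_pivot eqxx ffunE eqxx.
under eq_bigr => k nki do
  rewrite ffunE lam_pivot (negPf nki) mulrBr [c _ * (_ * _)]mulrA.
rewrite sumrB -mulr_suml [\sum_k _ * lam f v k](bigD1 i) //=.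
rewrite [\sum_k _ * lam f (col j a) k](bigD1 i) //= -/mu.
set x := lam f v i / mu i; have -> : lam f v i = mu i * x by rewrite mulrC
  divfK.
ring.
Qed.

End Pivot.
End Bases.

(** * Cells and the simplex method *)

Section Simplex.
Variables (R : realFieldType) (d n : nat) (a : 'M[R]_(d, n)).
Implicit Types (f g : {ffun 'I_d -> 'I_n}) (i k : 'I_d) (j : 'I_n).
Implicit Types (v w : 'cV[R]_d) (c : 'I_n -> R).

(** Strictness off the generators makes [codom f] the whole set of tight columns, as [in_Delta]
    requires. *)
Definition cell c f : bool := (basis_mx a f \in unitmx) &&
  [forall j, (j \notin codom f) ==> (price a c f (col j a) < c j)].

Definition nonneg_comb v : Prop :=
  exists2 x : 'I_n -> R, (forall j, 0 <= x j) & \sum_j x j *: col j a = v.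

(** Genericity of [c]: no dual solution is degenerate, so weak dual feasibility is already
    strict. *)
Definition separated c : Prop := forall f, basis_mx a f \in unitmx ->
  forall j, j \notin codom f -> price a c f (col j a) != c j.

Lemma cellP c f : reflect (basis_mx a f \in unitmx /\
   forall j, j \notin codom f -> price a c f (col j a) < c j) (cell c f).
Proof.
apply: (iffP andP) => -[uf H]; split=> //.
  by move=> j; move/forallP/(_ j)/implyP: H.
by apply/forallP => j; apply/implyP/H.
Qed.

Lemma cell_unit c f : cell c f -> basis_mx a f \in unitmx.
Proof. by case/andP. Qed.

Lemma cell_le c f j : cell c f -> price a c f (col j a) <= c j.
Proof.
case/cellP=> uf H; have [/codomP[k ->]|/H/ltW//] := boolP (j \in codom f).
by rewrite price_col.
Qed.

Lemma separated_cell c f : separated c -> basis_mx a f \in unitmx ->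
  (forall j, price a c f (col j a) <= c j) -> cell c f.
Proof.
move=> sc uf H; apply/cellP; split=> // j nj.
by rewrite lt_neqAle H sc.
Qed.

(* A basis around [v] of minimal price is dual feasible: otherwise a pivot
   strictly decreases the price, [v] being nondegenerate. *)
Lemma primal_simplex c v f0 : separated c ->
  (forall x : 'I_n -> R, (forall j, 0 <= x j) ->
     \sum_j x j *: col j a = 0 -> forall j, x j = 0) ->
  (forall f, basis_mx a f \in unitmx -> forall k, lam a f v k != 0) ->
  basis_mx a f0 \in unitmx -> (forall k, 0 < lam a f0 v k) ->
  exists f, cell c f.
Proof.
move=> sc ker nondeg uf0 pos0.
pose P f := (basis_mx a f \in unitmx) && [forall k, 0 < lam a f v k].
have P0 : P f0 by rewrite /P uf0; apply/forallP.
case: (arg_minP (fun f => price a c f v) P0) => f /andP[uf /forallP pos] minf.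
exists f; apply: separated_cell => // j; rewrite leNgt; apply/negP => lt_j.
(* Otherwise [col j a] minus its expansion is a nonnegative relation among the columns with
   coefficient 1 at [j]. *)
have [i mu_i] : exists i, 0 < lam a f (col j a) i.
  apply/existsP; rewrite -[X in is_true X]negbK negb_exists.
  apply/negP => /forallP npos.
  pose x l : R := (l == j)%:R - \sum_k lam a f (col j a) k * (l == f k)%:R.
  have x0 l : 0 <= x l.
    rewrite addr_ge0 ?ler0n // -sumrN sumr_ge0 // => k _.
    by rewrite -mulNr mulr_ge0 ?ler0n // oppr_ge0 leNgt npos.
  have : x j = 0.
    suff e0 : \sum_l x l *: col l a = 0 by exact: (ker _ x0 e0 j).
    under eq_bigr do rewrite scalerBl scaler_suml.
    rewrite sumrB exchange_big /= (bigD1 j) //= eqxx scale1r big1 ?addr0.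
      rewrite -[X in X - _](lamK (col j a) uf) -sumrB big1 // => k _.
      rewrite (bigD1 (f k)) //= eqxx mulr1 big1 ?addr0 ?subrr // => l /negPf nl.
      by rewrite nl mulr0 scale0r.
    by move=> l /negPf->; rewrite scale0r.
  have nj : j \notin codom f.
    by apply/negP => /codomP[k ejk]; move: lt_j; rewrite ejk price_col // ltxx.
  rewrite /x eqxx big1 ?subr0 => [/eqP|k _]; first by rewrite oner_eq0.
  case: eqP => [ejk|]; last by rewrite mulr0.
  by move: nj; rewrite ejk codom_f.
(* Primal ratio test: the leaving index attains the least ratio, so the coordinates of [v] stay
   nonnegative, and positive by [nondeg]. *)
case: (@arg_minP _ _ _ i (fun k => 0 < lam a f (col j a) k)
  (fun k => lam a f v k / lam a f (col j a) k) mu_i).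
move=> {mu_i}i mu_i mini.
have nz : lam a f (col j a) i != 0 by rewrite gt_eqF.
have s0 : 0 < lam a f v i / lam a f (col j a) i by rewrite divr_gt0.
have uf' := pivot_unit uf nz.
have /minf : P (pivot f i j).
  rewrite /P uf'; apply/forallP => k; rewrite lt_neqAle eq_sym nondeg //=.
  rewrite lam_pivot //; case: eqP => [_|/eqP nki]; first exact: ltW.
  rewrite subr_ge0; have [mk|mk] := ltP 0 (lam a f (col j a) k).
    by rewrite mulrC -ler_pdivlMr // mini.
  by rewrite (le_trans _ (ltW (pos k))) // pmulr_lle0.
rewrite price_pivot // lerDl leNgt; case/negP.
by rewrite pmulr_llt0 // subr_lt0.
Qed.

(* Among all cells, one of maximal price at [v] contains [v]: otherwise moving
   the dual solution along an edge reaches a cell of larger price. *)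
Lemma dual_simplex c v f0 : separated c -> cell c f0 -> nonneg_comb v ->
  exists2 f, cell c f & forall k, 0 <= lam a f v k.
Proof.
move=> sc c0 [x x0 ev].
case: (arg_maxP (fun f => price a c f v) c0) => f cf maxf; exists f => // i.
rewrite leNgt; apply/negP => neg_i; have uf := cell_unit cf.
have [j mu_j] : exists j, lam a f (col j a) i < 0.
  apply/existsP; rewrite -[X in is_true X]negbK negb_exists.
  apply/negP => /forallP npos; move: neg_i; rewrite -ev lam_sum ltNge.
  by rewrite sumr_ge0 // => j _; rewrite mulr_ge0 // leNgt npos.
(* Dual ratio test: the entering column is one whose constraint first becomes tight along the
   edge. *)
case: (@arg_minP _ _ _ j (fun j => lam a f (col j a) i < 0)
  (fun j => (c j - price a c f (col j a)) / - lam a f (col j a) i) mu_j).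
move=> {mu_j}j mu_j minj.
have nz : lam a f (col j a) i != 0 by rewrite lt_eqF.
have gap_j : 0 < c j - price a c f (col j a).
  rewrite subr_gt0 lt_neqAle cell_le // sc //.
  apply/negP => /codomP[k ejk]; move: mu_j; rewrite ejk lam_col //.
  by rewrite ltNge ler0n.
have /maxf : cell c (pivot f i j).
  apply: separated_cell => // [|l]; first exact: pivot_unit.
  rewrite price_pivot // -lerBrDl mulrCA.
  have [ml|ml] := ltP (lam a f (col l a) i) 0.
    have := minj _ ml.
    rewrite ler_pdivlMr ?oppr_gt0 // invrN [_ * - _^-1]mulrN mulrNN.
    by rewrite mulrC.
  apply: le_trans (_ : 0 <= _); last by rewrite subr_ge0 cell_le.
  by rewrite mulr_ge0_le0 // nmulr_lle0 ?invr_lt0 // ltW.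
rewrite /= price_pivot // gerDl leNgt; case/negP.
by rewrite pmulr_rgt0 // nmulr_rgt0 // invr_lt0.
Qed.
End Simplex.

(** * A lexicographic cost *)

(** One threshold for finitely many polynomials: beyond it leading coefficients decide all signs, so
    a large [t] can replace an infinitesimal. *)
Lemma sign_at_infinity (R : realFieldType) (I : finType) (p : I -> {poly R}) :
  exists M, forall t, M <= t -> forall i, p i != 0 ->
    0 < (p i).[t] * lead_coef (p i).
Proof.
have H i : exists M, p i != 0 -> forall t, M <= t ->
    0 < (p i).[t] * lead_coef (p i).
  have [lt0|lt0|/eqP] := ltgtP (lead_coef (p i)) 0; last first.
  - by rewrite lead_coef_eq0 => /eqP->; exists 0; rewrite eqxx.
  - have [M HM] := poly_pinfty_gt_lc lt0; exists M => _ t /HM le_t.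
    by rewrite mulr_gt0 // (lt_le_trans lt0).
  have lt0' : 0 < lead_coef (- p i) by rewrite lead_coefN oppr_gt0.
  have [M HM] := poly_pinfty_gt_lc lt0'; exists M => _ t /HM le_t.
  by rewrite -mulrNN -hornerN -lead_coefN mulr_gt0 // (lt_le_trans lt0').
have [M HM] := fin_all_exists H.
exists (\sum_i `|M i|) => t le_t i pi0; apply: HM => //.
apply: le_trans (ler_norm _) _; apply: le_trans le_t.
by rewrite (bigD1 i) //= lerDl sumr_ge0.
Qed.

Section GenericChoices.
Variables (R : realFieldType) (d n : nat) (a : 'M[R]_(d, n)).
Implicit Types (f g : {ffun 'I_d -> 'I_n}) (i k : 'I_d) (j : 'I_n).

(** Take coordinates [t ^ i] in the basis [f0]. A coordinate in another basis [f] is a polynomial in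
    [t]; were it zero, coordinate [k] would vanish on all of [f0], hence on [col (f k) a], where it
    is 1. *)
Lemma nondegenerate_point f0 : basis_mx a f0 \in unitmx ->
  exists v, (forall k, 0 < lam a f0 v k) /\
    forall f, basis_mx a f \in unitmx -> forall k, lam a f v k != 0.
Proof.
move=> uf0; pose p (x : {ffun 'I_d -> 'I_n} * 'I_d) :=
  \sum_(i < d) lam a x.1 (col (f0 i) a) x.2 *: 'X^i.
have [M HM] := sign_at_infinity p; pose t := `|M| + 1.
have Mt : M <= t by rewrite (le_trans (ler_norm M)) // lerDl ler01.
have t0 : 0 < t by rewrite ltr_wpDl.
exists (\sum_(i < d) t ^+ i *: col (f0 i) a); split=> [k|f uf k].
  rewrite (lam_uniq (w := fun k : 'I_d => t ^+ k) uf0 erefl).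
  exact: exprn_gt0.
have -> : lam a f (\sum_(i < d) t ^+ i *: col (f0 i) a) k = (p (f, k)).[t].
  rewrite horner_sum lam_sum; apply: eq_bigr => i _.
  by rewrite hornerZ hornerXn mulrC.
suff /(HM t Mt) : p (f, k) != 0 by apply: contraTneq => ->; rewrite mul0r ltxx.
apply/eqP => p0; have := lam_col k k uf.
rewrite -[col (f k) a](lamK _ uf0) lam_sum eqxx big1 => [/eqP|i _].
  by rewrite eq_sym oner_eq0.
have /(congr1 (fun q : {poly R} => q`_i)) := p0.
rewrite coef_sum coef0 (bigD1 i) //= big1 => [|l nli].
  by rewrite coefZ coefXn eqxx mulr1 addr0 => ->; rewrite mulr0.
by rewrite coefZ coefXn eq_sym (inj_eq val_inj) (negPf nli) mulr0.
Qed.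

(* [q] refines the hull of the columns, [t ^ k] breaks the remaining ties. *)
Lemma lexicographic_cost (q : 'I_n -> R) : exists c, separated a c /\
  forall f, cell a c f -> forall j, 1 <= height a f (col j a) /\
    (height a f (col j a) = 1 -> price a q f (col j a) <= q j).
Proof.
pose C (k : 'I_n) : {poly R} := 'X^k + q k *: 'X^n - 'X^(n.+1).
have coefC (k : 'I_n) m : (C k)`_m = (m == k)%:R + q k * (m == n)%:R - (m ==
  n.+1)%:R.
  by rewrite coefB coefD coefZ !coefXn.
(* The reduced cost of a column as a polynomial in [t]. Its coefficients of degree [n.+1] and [n]
   are [height - 1] and the slack of [q]. *)
pose p (x : {ffun 'I_d -> 'I_n} * 'I_n) :=
  C x.2 - \sum_k lam a x.1 (col x.2 a) k *: C (x.1 k).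
have coefp f j m : (p (f, j))`_m =
    (C j)`_m - \sum_k lam a f (col j a) k * (C (f k))`_m.
  rewrite coefB coef_sum; congr (_ - _); apply: eq_bigr => k _.
  by rewrite coefZ.
have [t /(_ _ (lexx _)) Ht] := sign_at_infinity p.
pose c (k : 'I_n) := (C k).[t]; exists c.
have hp f j : (p (f, j)).[t] = c j - price a c f (col j a).
  rewrite hornerD hornerN horner_sum; congr (_ - _); apply: eq_bigr => k _.
  by rewrite hornerZ mulrC.
(* Outside the basis the coefficient of degree [j] is 1, because no generator contributes to that
   degree. *)
have p_neq0 f j : j \notin codom f -> p (f, j) != 0.
  move=> nj; apply/eqP => /(congr1 (fun q : {poly R} => q`_j)).
  rewrite coefp coef0 coefC eqxx !ltn_eqF ?ltn_ord ?(ltnW (ltn_ord _)) //.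
    rewrite mulr0 addr0 subr0 big1 => [/eqP|k _];
      first by rewrite subr0 oner_eq0.
    rewrite coefC (_ : _ == _ = false); last first.
      by apply/eqP => /val_inj e; rewrite e codom_f in nj.
    by rewrite !ltn_eqF ?ltnS ?ltn_ord ?(ltnW (ltn_ord _)) // mulr0 !addr0
      subr0 mulr0.
  by rewrite ltnS ltnW.
split=> [f uf j nj|f cf j].
  rewrite eq_sym -subr_eq0 -hp.
  by have := Ht _ (p_neq0 _ _ nj); apply: contraTneq => ->; rewrite mul0r ltxx.
have uf := cell_unit cf.
have [/codomP[k ->]|nj] := boolP (j \in codom f).
  rewrite heightE !price_col //; split=> //.
have lead0 : 0 < lead_coef (p (f, j)).
  have := Ht _ (p_neq0 _ _ nj); rewrite pmulr_rgt0 // hp subr_gt0.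
  by case/cellP: cf => _; apply.
have coef_n1 : (p (f, j))`_n.+1 = height a f (col j a) - 1.
  have Cn1 (k : 'I_n) : (C k)`_n.+1 = -1.
    by rewrite coefC eqxx gtn_eqF ?ltnS 1?ltnW // gtn_eqF // mulr0 !add0r.
  by rewrite coefp Cn1; under eq_bigr do rewrite Cn1 mulrN1;
    rewrite sumrN opprK addrC.
have coef_n : (p (f, j))`_n = q j - price a q f (col j a).
  have Cn (k : 'I_n) : (C k)`_n = q k.
    by rewrite coefC eqxx gtn_eqF // ltn_eqF // mulr1 add0r subr0.
  by rewrite coefp Cn; congr (_ - _); apply: eq_bigr => k _; rewrite Cn mulrC.
have size_p m : (forall l, (m < l)%N -> (p (f, j))`_l = 0) ->
    (p (f, j))`_m != 0 -> lead_coef (p (f, j)) = (p (f, j))`_m.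
  move=> hi nz; rewrite lead_coefE; congr (_`_ _).
  have -> // : size (p (f, j)) = m.+1.
  apply/eqP; rewrite eqn_leq; apply/andP; split.
    by apply/leq_sizeP => l; apply: hi.
  by rewrite ltnNge; apply: contraNN nz => /leq_sizeP/(_ m (leqnn m))->.
have hi l : (n.+1 < l)%N -> (p (f, j))`_l = 0.
  move=> lt_l; have C0 (k : 'I_n) : (C k)`_l = 0.
    have ltn_l : (n < l)%N by apply: ltn_trans lt_l.
    rewrite coefC !gtn_eqF ?(ltn_trans (ltn_ord k)) //.
    by rewrite mulr0 !addr0 subr0.
  by rewrite coefp C0 big1 ?subr0 // => k _; rewrite C0 mulr0.
have [h1|h1] := eqVneq (height a f (col j a)) 1.
  split=> [|_]; first by rewrite h1.
  rewrite -subr_ge0 -coef_n; have [->//|nz] := eqVneq (p (f, j))`_n 0.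
  rewrite -size_p ?ltW // => l; rewrite leq_eqVlt => /predU1P[<-|/hi//].
  by rewrite coef_n1 h1 subrr.
have nz : (p (f, j))`_n.+1 != 0 by rewrite coef_n1 subr_eq0.
split=> [|e]; last by rewrite e eqxx in h1.
by rewrite -subr_ge0 -coef_n1 -size_p // ltW.
Qed.
End GenericChoices.

(** * Lattice points of a cell *)

Section Lattice.
Variables (R : archiRealFieldType) (d n : nat) (a : 'M[R]_(d, n)).
Implicit Types (f g : {ffun 'I_d -> 'I_n}) (i k : 'I_d) (j : 'I_n).
Implicit Types (v w z : 'cV[R]_d) (c : 'I_n -> R).

Local Notation int_num := (@Num.int R).
Definition latt v : Prop := forall r, v r 0 \is a int_num.

Definition half_open f v : bool := [forall k, 0 <= lam a f v k < 1].

(** Nonnegative integral coordinates of sum at most 1 mean that [z] is 0 or a generator. *)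
Definition empty_simplex f : Prop := forall z, latt z ->
  (forall k, 0 <= lam a f z k) -> height a f z <= 1 ->
  forall k, lam a f z k \is a int_num.

Definition box_in_columns f : Prop := forall z, latt z ->
  z != 0 -> half_open f z -> exists j, z = col j a.

Definition unimodular f : Prop :=
  forall z, latt z -> forall k, lam a f z k \is a int_num.

Hypothesis aZ : forall r j, a r j \is a int_num.

Lemma latt_col j : latt (col j a).
Proof. by move=> r; rewrite mxE. Qed.

Lemma lattB v w : latt v -> latt w -> latt (v - w).
Proof. by move=> vZ wZ r; rewrite !mxE rpredB. Qed.

Lemma latt_comb (w : 'I_d -> R) f : (forall k, w k \is a int_num) ->
  latt (\sum_k w k *: col (f k) a).
Proof.
move=> wZ r; rewrite summxE rpred_sum // => k _.
by rewrite !mxE rpredM.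
Qed.

Lemma int_lt1 (x : R) : x \is a int_num -> 0 <= x -> x < 1 -> x = 0.
Proof.
case/intrP => m ->; rewrite ler0z -[1]/(1%:~R) ltr_int => m0 m1.
by have -> : m = 0 by apply/eqP; rewrite eq_le -ltzD1 add0r m1 m0.
Qed.

Lemma lam_eq0 f v : basis_mx a f \in unitmx -> (forall k, lam a f v k = 0) ->
  v = 0.
Proof.
by move=> uf v0; rewrite -(lamK v uf) big1 // => k _; rewrite v0 scale0r.
Qed.

Lemma half_openP f v : reflect (forall k, 0 <= lam a f v k < 1) (half_open f v).
Proof. exact: forallP. Qed.

Lemma frac_part f z : basis_mx a f \in unitmx -> latt z ->
  exists x, [/\ latt x, half_open f x &
    forall k, lam a f x k = lam a f z k - (Num.floor (lam a f z k))%:~R].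
Proof.
move=> uf zZ.
pose y := \sum_k (Num.floor (lam a f z k))%:~R *: col (f k) a.
exists (z - y).
have ly k : lam a f (z - y) k = lam a f z k - (Num.floor (lam a f z k))%:~R.
  by rewrite lamB (lam_uniq (w := fun k => (Num.floor (lam a f z k))%:~R) uf
    erefl).
split=> //.
  by apply: lattB => //; apply: latt_comb => k; rewrite intr_int.
apply/half_openP => k; rewrite ly subr_ge0 floor_le ltrBlDl.
by have := floorD1_gt (lam a f z k); rewrite intrD.
Qed.

(** Reflection in the centre of the face of the box spanned by [z]. Zero coordinates stay 0, which
    keeps the image in the half-open box. *)
Lemma complement f z : basis_mx a f \in unitmx -> latt z -> half_open f z ->
  exists x, [/\ latt x,
    forall k, lam a f x k = (lam a f z k != 0)%:R - lam a f z k,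
    half_open f x &
    height a f x + height a f z = #|[set k | lam a f z k != 0]|%:R].
Proof.
move=> uf zZ /half_openP hz.
pose y := \sum_k (lam a f z k != 0)%:R *: col (f k) a; exists (y - z).
have ly k : lam a f (y - z) k = (lam a f z k != 0)%:R - lam a f z k.
  by rewrite lamB (lam_uniq (w := fun k => (lam a f z k != 0)%:R) uf erefl).
split=> //.
- by apply: lattB => //; apply: latt_comb => k; rewrite natr_int.
- apply/half_openP => k; rewrite ly; have /andP[z0 z1] := hz k.
  case: eqP => [->|/eqP nz] /=; first by rewrite subr0 lexx ltr01.
  by rewrite subr_ge0 ltW // ltrBlDl ltrDr lt_neqAle eq_sym nz.
rewrite /height -big_split /= -sum1_card natr_sum [RHS]big_mkcond /=.
by apply: eq_bigr => k _; rewrite ly inE subrK; case: (_ != _).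
Qed.

Section Initial.
Hypothesis d3 : (d <= 3)%N.
Hypothesis normal : forall v, latt v -> nonneg_comb a v ->
  exists u : 'I_n -> nat, v = \sum_j (u j)%:R *: col j a.
Variable f : {ffun 'I_d -> 'I_n}.
Hypothesis uf : basis_mx a f \in unitmx.
Hypothesis height1 : forall j, 1 <= height a f (col j a).

Lemma cone_nonneg_comb v : (forall k, 0 <= lam a f v k) -> nonneg_comb a v.
Proof.
move=> v0; exists (fun j => spread f (lam a f v) j 0) => [j|].
  exact: spread_ge0.
by rewrite -mulmx_sum_col mulmx_spread lamK.
Qed.

(** Normality writes [v] as a natural combination of columns; as each has height at least 1, at most
    one is used. *)
Lemma latt_small v : latt v -> nonneg_comb a v -> height a f v < 2 ->
  v = 0 \/ exists j, v = col j a.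
Proof.
move=> vZ /(normal vZ)[u ->]; rewrite heightE price_sum => hv.
have {hv}: (\sum_j u j < 2)%N.
  rewrite -(ltr_nat R) natr_sum (le_lt_trans _ hv) // ler_sum // => j _.
  by rewrite -heightE ler_peMr // ler0n.
case su: (\sum_j u j)%N => [|[|//]] _.
  left; rewrite big1 // => j _.
  by move/eqP: su; rewrite sum_nat_eq0 => /forall_inP/(_ j isT)/eqP->;
    rewrite scale0r.
right; move/eqP/sum_nat_eq1: su => [j [_ uj u0]]; exists j.
rewrite (bigD1 j) //= uj scale1r big1 ?addr0 // => l nl.
by rewrite u0 // scale0r.
Qed.

(* If [z = \sum_k x_k v_k] with [\sum_k x_k = 1], then
   [\sum_k x_k |v_k|^2 - |z|^2 = \sum_k x_k |v_k - z|^2]. *)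
Lemma empty_simplex_init :
  (forall j, height a f (col j a) = 1 ->
    price a (fun l => \sum_r a r l ^+ 2) f (col j a) <= \sum_r a r j ^+ 2) ->
  empty_simplex f.
Proof.
move=> convex z zZ z0 z1 k.
have [|->|[j ej]] := latt_small zZ (cone_nonneg_comb z0).
- by rewrite (le_lt_trans z1) // ltr1n.
- by rewrite lam0 int_num0.
have h1 : height a f (col j a) = 1 by apply/eqP; rewrite eq_le height1 -ej z1.
have /convex := h1; rewrite -subr_le0 => le0.
pose D k : R := \sum_r (a r (f k) - a r j) ^+ 2.
have D0 l : 0 <= D l by rewrite sumr_ge0 // => r _; rewrite sqr_ge0.
have eD : \sum_k lam a f z k * D k =
    price a (fun l => \sum_r a r l ^+ 2) f (col j a) - \sum_r a r j ^+ 2.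
  have zr r : \sum_k lam a f z k * a r (f k) = a r j.
    transitivity (z r 0); last by rewrite ej mxE.
    by rewrite -{2}(lamK z uf) summxE; apply: eq_bigr => l _; rewrite !mxE.
  have lam1 : \sum_k lam a f z k = 1 by rewrite -[LHS]/(height a f z) ej.
  have D_r r : \sum_k lam a f z k * (a r (f k) - a r j) ^+ 2 =
      \sum_k lam a f z k * a r (f k) ^+ 2 - a r j ^+ 2.
    transitivity (\sum_k (lam a f z k * a r (f k) ^+ 2 -
        (lam a f z k * a r (f k)) * (2 * a r j) + lam a f z k * a r j ^+ 2)).
      by apply: eq_bigr => l _; ring.
    by rewrite big_split sumrB -!mulr_suml zr lam1 /=; ring.
  rewrite /price -ej /D; under eq_bigr do rewrite mulr_sumr.
  rewrite exchange_big /=; under eq_bigr do rewrite D_r.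
  rewrite sumrB; congr (_ - _); rewrite exchange_big /=.
  by apply: eq_bigr => l _; rewrite mulr_suml; apply: eq_bigr => r _; ring.
have terms0 l : true -> 0 <= lam a f z l * D l by rewrite mulr_ge0.
(* A sum of nonnegative terms that is at most 0: a generator with nonzero coordinate is at distance
   0 from [z]. *)
have /(psumr_eq0P terms0)/(_ k isT)/eqP : \sum_l lam a f z l * D l = 0.
  by apply/eqP; rewrite eq_le sumr_ge0 // eD le0.
rewrite mulf_eq0 => /orP[/eqP->|/eqP Dk]; first exact: int_num0.
have -> : z = col (f k) a.
  apply/matrixP => r s; rewrite (ord1 s) ej !mxE; apply/eqP.
  rewrite eq_sym -subr_eq0 -sqrf_eq0.
  by move/psumr_eq0P: Dk => -> // l _; rewrite sqr_ge0.
by rewrite lam_col // eqxx int_num1.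
Qed.

Lemma box_in_columns_init : empty_simplex f -> box_in_columns f.
Proof.
move=> es z zZ nz hz; have [x [xZ lx hx hxz]] := complement uf zZ hz.
have z0 k : 0 <= lam a f z k by have /half_openP/(_ k)/andP[] := hz.
have x0 k : 0 <= lam a f x k by have /half_openP/(_ k)/andP[] := hx.
have [|z_eq0|//] := latt_small zZ (cone_nonneg_comb z0); last first.
  by rewrite z_eq0 eqxx in nz.
(* Otherwise emptiness makes the coordinates of [x] integral, hence 0; those of [z] would be 0 or 1,
   and 1 is excluded by half-openness. *)
have x1 : 1 < height a f x.
  rewrite ltNge; apply/negP => /(es _ xZ x0) xint.
  case/eqP: nz; apply: (lam_eq0 uf) => k.
  have := int_lt1 (xint k) (x0 k); have /half_openP/(_ k)/andP[_ ->] := hx.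
  move=> /(_ isT); rewrite lx; case: eqP => //= _ /eqP.
  by rewrite subr_eq0 => /eqP e; have /half_openP/(_ k)/andP[_] := hz;
    rewrite -e ltxx.
have : (#|[set k | lam a f z k != 0]|%:R : R) <= 3.
  by rewrite ler_nat (leq_trans (max_card _)) // card_ord.
rewrite -hxz; lra.
Qed.
End Initial.
End Lattice.

(** * Subdividing one cell at a lowest column of its box *)

Section StellarStep.
Variables (R : archiRealFieldType) (d n : nat) (a : 'M[R]_(d, n)).
Implicit Types (g : {ffun 'I_d -> 'I_n}) (i k : 'I_d).
Implicit Types (v w z : 'cV[R]_d) (c : 'I_n -> R).

Local Notation int_num := (@Num.int R).

Hypothesis aZ : forall r j, a r j \is a int_num.
Hypothesis d3 : (d <= 3)%N.
Hypothesis col_neq0 : forall j, col j a != 0.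
Variable f : {ffun 'I_d -> 'I_n}.
Hypothesis uf : basis_mx a f \in unitmx.
Hypothesis box : box_in_columns a f.

Lemma unimodular_or_column :
  (exists j, half_open a f (col j a)) \/ unimodular a f.
Proof.
have [/existsP|nex] := boolP [exists j, half_open a f (col j a)]; first by left.
right=> z zZ k; have [x [xZ hx lx]] := frac_part aZ uf zZ.
have [x0|nz] := eqVneq x 0.
  move: (lx k); rewrite x0 lam0 => /esym/eqP; rewrite subr_eq0 => /eqP->.
  exact: intr_int.
have [j ej] := box xZ nz hx; case/existsP: nex; exists j; by rewrite -ej.
Qed.

Hypothesis es : empty_simplex a f.
Variable j : 'I_n.
Hypothesis hj : half_open a f (col j a).
Hypothesis minj : forall l, half_open a f (col l a) ->
  height a f (col j a) <= height a f (col l a).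

Local Notation mu := (lam a f (col j a)).
Local Notation H := (height a f (col j a)).

Lemma mu_itv k : 0 <= mu k < 1.
Proof. by have /half_openP/(_ k) := hj. Qed.

(** Removing the nonnegative integer parts does not raise the height. The remainder is a nonzero
    point of the box, hence a column, and minimality of [j] applies. *)
Lemma nonint_height z k : latt z -> (forall l, 0 <= lam a f z l) ->
  lam a f z k \isn't a int_num -> H <= height a f z.
Proof.
move=> zZ z0 nint; have [x [xZ hx lx]] := frac_part aZ uf zZ.
have nz : x != 0.
  apply: contraNneq nint => x0; move: (lx k).
  rewrite x0 lam0 => /esym/eqP; rewrite subr_eq0 => /eqP->.
  exact: intr_int.
have [l ex] := box xZ nz hx; apply: (@le_trans _ _ (height a f x)).
  by rewrite ex; apply: minj; rewrite -ex.
apply: ler_sum => l' _; rewrite lx gerBl ler0z floor_ge0.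
exact: z0.
Qed.

Lemma nonint01 (x : R) : 0 < x < 1 -> x \isn't a int_num.
Proof.
case/andP=> x0 x1; apply/negP => /int_lt1 /(_ (ltW x0) x1) e.
by rewrite e ltxx in x0.
Qed.

Lemma min_height_gt1 : 1 < H.
Proof.
rewrite ltNge; apply/negP => H1.
have /negP[] := col_neq0 j; apply/eqP/(lam_eq0 uf) => k.
have /andP[m0 m1] := mu_itv k; apply: int_lt1 m1 => //.
apply: es H1 _ => //; first exact: latt_col.
by move=> l; have /andP[] := mu_itv l.
Qed.

(** If a coordinate vanished, the column and its complement would have heights of sum at most
    [d - 1 <= 2], while both are at least [H > 1]. *)
Lemma mu_gt0 k : 0 < mu k.
Proof.
have /andP[m0 _] := mu_itv k; rewrite lt_neqAle m0 andbT eq_sym.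
apply/negP => /eqP mk.
have [x [xZ lx hx hxj]] := complement aZ uf (latt_col aZ j) hj.
have [l ml] : exists l, mu l != 0.
  apply/existsP; rewrite -[X in is_true X]negbK negb_exists.
  apply/negP => /forallP m_0; have /negP[] := col_neq0 j.
  by apply/eqP/(lam_eq0 uf) => l; apply/eqP; rewrite -[X in is_true X]negbK.
have Hx : H <= height a f x.
  apply: (@nonint_height x l) => // [l'|].
    by have /half_openP/(_ l')/andP[] := hx.
  apply: nonint01; rewrite lx ml /=; have /andP[ml0 ml1] := mu_itv l.
  by rewrite subr_gt0 ml1 ltrBlDl ltrDr lt_neqAle eq_sym ml.
have : (#|[set l | mu l != 0]|%:R : R) <= 2.
  rewrite ler_nat -ltnS (leq_trans _ d3) // -[X in (_ < X)%N]card_ord.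
  apply: proper_card; apply/properP; split; first exact/subsetP.
  by exists k => //; rewrite inE mk eqxx.
rewrite -hxj; have := min_height_gt1; lra.
Qed.

Variable i : 'I_d.
Local Notation t := (pivot f i j).

Let mu_i_neq0 : mu i != 0.
Proof. by rewrite gt_eqF ?mu_gt0. Qed.

Let ut : basis_mx a t \in unitmx.
Proof. exact: pivot_unit. Qed.

Lemma lam_of_pivot v k :
  lam a f v k = (k != i)%:R * lam a t v k + lam a t v i * mu k.
Proof.
rewrite !lam_pivot // eqxx; case: eqP => [->|_] /=.
  by rewrite mul0r add0r divfK.
by rewrite mul1r mulrC subrK.
Qed.

(** The old height is 1 on the kept generators and [H] on the new one. *)
Lemma height_of_pivot v :
  height a f v = height a t v + lam a t v i * (H - 1).
Proof.
rewrite /height; under eq_bigr do rewrite lam_of_pivot.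
rewrite big_split /= -mulr_sumr (bigD1 i) //= eqxx mul0r add0r.
rewrite [in RHS](bigD1 i) //= mulrBr mulr1.
under eq_bigr => k -> do rewrite mul1r.
by ring.
Qed.

Lemma lam_ge0_of_pivot z : (forall k, 0 <= lam a t z k) ->
  forall k, 0 <= lam a f z k.
Proof.
move=> z0 k; rewrite lam_of_pivot addr_ge0 ?mulr_ge0 //.
by rewrite ltW ?mu_gt0.
Qed.

Lemma pivot_coord_nonint z : 0 < lam a t z i < 1 ->
  lam a f z i \isn't a int_num.
Proof.
case/andP=> z0 z1; apply: nonint01; rewrite lam_of_pivot eqxx mul0r add0r.
have /andP[_ m1] := mu_itv i; have m0 := mu_gt0 i.
rewrite mulr_gt0 //= (lt_trans _ z1) // -[X in _ < X]mulr1.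
by rewrite ltr_pM2l.
Qed.

(** If the old coordinates of [z] are integral, the one at [i] is below 1, so [z] has no share of
    the new generator and its other coordinates are unchanged. Otherwise the old height is at least
    [H], which forces [z] to be the new generator. *)
Lemma empty_simplex_pivot : empty_simplex a t.
Proof.
move=> z zZ z0 z1; have zf0 := lam_ge0_of_pivot z0.
have le_height k : lam a t z k <= height a t z.
  by rewrite /height (bigD1 k) //= lerDl sumr_ge0.
have [/forallP zint|] := boolP [forall k, lam a f z k \is a int_num].
  have zi : lam a t z i = 0.
    have := zint i; have := zf0 i.
    rewrite lam_of_pivot eqxx mul0r add0r => zi0 /int_lt1 /(_ zi0) e.
    have /eqP : lam a t z i * mu i = 0.
      apply: e; have /andP[_ m1] := mu_itv i.
      apply: le_lt_trans m1; rewrite ler_piMl ?(ltW (mu_gt0 i)) //.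
      exact: le_trans (le_height i) z1.
    by rewrite mulf_eq0 (negPf mu_i_neq0) orbF => /eqP.
  move=> k; have := zint k; rewrite lam_of_pivot zi mul0r addr0.
  by case: eqP => [->|_]; rewrite ?zi ?int_num0 // mul1r.
rewrite negb_forall => /existsP[k /(nonint_height zZ zf0)].
rewrite (height_of_pivot z) => Hz; have H1 := min_height_gt1.
have zi : lam a t z i = 1.
  apply/eqP; rewrite eq_le (le_trans (le_height i)) //=.
  rewrite leNgt; apply/negP => zi1.
  have : 0 < (H - 1) * (1 - lam a t z i) by rewrite mulr_gt0 ?subr_gt0.
  by nra.
have rest : \sum_(l | l != i) lam a t z l <= 0.
  by move: z1; rewrite /height (bigD1 i) //= zi gerDl.
move=> l; have [->|nli] := eqVneq l i; first by rewrite zi int_num1.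
have -> : lam a t z l = 0; last exact: int_num0.
apply/eqP; rewrite eq_le z0 andbT (le_trans _ rest) //.
by rewrite (bigD1 l) //= lerDl sumr_ge0.
Qed.

Lemma half_open_pivot z : latt z -> half_open a t z -> half_open a f z.
Proof.
move=> zZ hz; have /half_openP zt := hz.
have z0 k : 0 <= lam a t z k by have /andP[] := zt k.
have zf0 := lam_ge0_of_pivot z0.
apply/half_openP => m; rewrite zf0 /= ltNge; apply/negP => zm.
(* Without a share of the new generator, old and new coordinates agree. *)
have [zi0|zi] := eqVneq (lam a t z i) 0.
  move: zm; rewrite lam_of_pivot zi0 mul0r addr0; have /andP[_ z1] := zt m.
  by case: eqP => _ /=; rewrite ?mul0r ?mul1r leNgt ?ltr01 ?z1.
have {}zi : 0 < lam a t z i by rewrite lt_neqAle eq_sym zi z0.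
have /andP[_ zi1] := zt i; have H1 := min_height_gt1.
have nmi : m != i.
  apply/eqP => emi; move: zm; rewrite emi lam_of_pivot eqxx mul0r add0r leNgt.
  case/negP; have /andP[_ m1] := mu_itv i; apply: lt_trans m1.
  by rewrite gtr_pMl ?mu_gt0.
(* Since [m != i], subtracting generator [m] leaves the old coordinate at [i] non-integral. *)
have Hy : H <= height a f (z - col (f m) a).
  apply: (@nonint_height _ i) => [|l|].
  - exact: lattB (latt_col _ _).
  - rewrite lamB lam_col //; case: eqP => [->|_]; first by rewrite subr_ge0.
    by rewrite subr0.
  rewrite lamB lam_col // eq_sym (negPf nmi) subr0 pivot_coord_nonint //.
  by rewrite zi zi1.
have [x [xZ lx hx hxz]] := complement aZ ut zZ hz.
have Hx : H <= height a f x.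
  apply: (@nonint_height _ i) => // [l|].
    by apply: lam_ge0_of_pivot => l'; have /half_openP/(_ l')/andP[] := hx.
  by apply: pivot_coord_nonint; rewrite lx gt_eqF //= subr_gt0 zi1 ltrBlDl
    ltrDr.
have hy : height a f (z - col (f m) a) = height a f z - 1.
  rewrite /height; under eq_bigr do rewrite lamB; rewrite sumrB; congr (_ - _).
  by rewrite -/(height a f _) heightE price_col.
have card3 : (#|[set k | lam a t z k != 0]|%:R : R) <= 3.
  by rewrite ler_nat (leq_trans (max_card _)) // card_ord.
have xi : lam a t x i = 1 - lam a t z i by rewrite lx gt_eqF.
rewrite hy in Hy; rewrite (height_of_pivot x) xi in Hx.
rewrite (height_of_pivot z) in Hy; rewrite -hxz in card3.
(* The new coordinates at [i] of [x] and [z] sum to 1, so the old heights sum to at most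
   [3 + (H - 1)]; hence [2 * H <= H + 1], against [H > 1]. *)
lra.
Qed.

Lemma box_in_columns_pivot : box_in_columns a t.
Proof. by move=> z zZ nz /(half_open_pivot zZ); apply: box. Qed.

Lemma half_open_pivot_new : ~~ half_open a t (col j a).
Proof.
apply/negP => /half_openP/(_ i)/andP[_].
by have := lam_col i i ut; rewrite ffunE eqxx => ->; rewrite ltxx.
Qed.
End StellarStep.

(** * Stellar refinement *)

Section CellGeometry.
Variables (R : realFieldType) (d n : nat) (a : 'M[R]_(d, n)).
Implicit Types (f g : {ffun 'I_d -> 'I_n}) (i k : 'I_d) (j : 'I_n).
Implicit Types (v w : 'cV[R]_d) (c : 'I_n -> R).

Lemma cell_price_le c f g v : cell a c f -> basis_mx a g \in unitmx ->
  (forall k, 0 <= lam a g v k) -> price a c f v <= price a c g v.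
Proof.
move=> cf ug v0; rewrite -{1}(lamK v ug) price_sum; apply: ler_sum => k _.
by rewrite mulrC ler_wpM2r // cell_le.
Qed.

(** A generator of [g] outside [f] has positive weight in [v]. Combined with [cell_price_le], an
    interior point of one cell lies in no other. *)
Lemma cell_price_lt c f g v : cell a c f -> basis_mx a g \in unitmx ->
  (forall k, 0 < lam a g v k) -> ~~ (codom g \subset codom f) ->
  price a c f v < price a c g v.
Proof.
move=> cf ug v0 /subsetPn[_ /codomP[k ->] nk].
rewrite -{1}(lamK v ug) price_sum /price (bigD1 k) //= [ltRHS](bigD1 k) //=.
rewrite ltr_leD //; last first.
  by apply: ler_sum => l _; rewrite mulrC ler_pM2r ?cell_le.
by rewrite mulrC ltr_pM2r //; case/cellP: cf => _; apply.
Qed.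

Lemma codom_sub_eq f g : basis_mx a f \in unitmx -> basis_mx a g \in unitmx ->
  codom f \subset codom g -> codom g \subset codom f.
Proof.
move=> /basis_mx_inj fi /basis_mx_inj gi sfg.
have /subset_cardP/(_ sfg) e : #|codom f| = #|codom g| by rewrite !card_codom.
by apply/subsetP => x; rewrite e.
Qed.

Lemma lam_ge0_codom f g v : basis_mx a f \in unitmx -> basis_mx a g \in unitmx
  ->
  codom g \subset codom f ->
  (forall k, 0 <= lam a g v k) -> forall k, 0 <= lam a f v k.
Proof.
move=> uf ug sgf v0 k; rewrite -(lamK v ug) lam_sum sumr_ge0 // => l _.
have /codomP[m ->] := subsetP sgf _ (codom_f g l).
by rewrite mulr_ge0 // lam_col // ler0n.
Qed.

Lemma price_eq c c' f v : {in codom f, c =1 c'} ->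
  price a c f v = price a c' f v.
Proof. by move=> e; apply: eq_bigr => k _; rewrite e ?codom_f. Qed.
End CellGeometry.

Section Refinement.
Variables (R : archiRealFieldType) (d n : nat) (a : 'M[R]_(d, n)).
Implicit Types (f g : {ffun 'I_d -> 'I_n}) (i k : 'I_d) (j : 'I_n).
Implicit Types (v w : 'cV[R]_d) (c : 'I_n -> R).
Implicit Types (T : {set {ffun 'I_d -> 'I_n}}).

(** Only covering is demanded, since regularity already makes cells meet in common faces; [T] may
    list a cell under several orderings. *)
Definition regular_cover c T : Prop :=
  (forall f, f \in T -> cell a c f) /\
  (forall v, nonneg_comb a v -> exists2 f, f \in T & forall k, 0 <= lam a f v
    k).

Definition box_columns T : {set 'I_n} :=
  [set j | [exists f in T, half_open a f (col j a)]].

Hypothesis aZ : forall r j, a r j \is a (@Num.int R).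
Hypothesis d3 : (d <= 3)%N.
Hypothesis col_neq0 : forall j, col j a != 0.

Section Step.
Variables (c : 'I_n -> R) (T : {set {ffun 'I_d -> 'I_n}}).
Hypothesis rc : regular_cover c T.
Hypothesis es : forall f, f \in T -> empty_simplex a f.
Hypothesis box : forall f, f \in T -> box_in_columns a f.
Variables (f : {ffun 'I_d -> 'I_n}) (j : 'I_n).
Hypothesis fT : f \in T.
Hypothesis hj : half_open a f (col j a).
Hypothesis minj : forall l, half_open a f (col l a) ->
  height a f (col j a) <= height a f (col l a).

Let cf : cell a c f. Proof. by case: rc => + _; apply. Qed.
Let uf : basis_mx a f \in unitmx. Proof. exact: cell_unit cf. Qed.
Let esf : empty_simplex a f. Proof. exact: es. Qed.
Let boxf : box_in_columns a f. Proof. exact: box. Qed.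
Let mu_gt0 k : 0 < lam a f (col j a) k.
Proof. exact: mu_gt0. Qed.
Let mu_neq0 k : lam a f (col j a) k != 0.
Proof. by rewrite gt_eqF. Qed.

Let njf : j \notin codom f.
Proof.
apply/negP => /codomP[k ej]; have /half_openP/(_ k) := hj.
by rewrite ej lam_col // eqxx ltxx andbF.
Qed.

(** Inclusion of codomains is used so that every reordering of [f] is removed too. *)
Definition stellar : {set {ffun 'I_d -> 'I_n}} :=
  [set g in T | ~~ (codom f \subset codom g)] :|: [set pivot f i j | i in 'I_d].

Lemma stellarP g : g \in stellar ->
  (g \in T /\ ~~ (codom f \subset codom g)) \/ exists i, g = pivot f i j.
Proof.
case/setUP => [|/imsetP[i _ ->]]; last by right; exists i.
by rewrite inE => /andP; left.
Qed.

Lemma stellar_price_lt g : g \in T -> ~~ (codom f \subset codom g) ->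
  price a c g (col j a) < price a c f (col j a).
Proof. by case: rc => H _ /H cg; apply: cell_price_lt. Qed.

(** Lower the cost of [j] to just below its price over [f]. Only the cells on the columns of [f] are
    violated, and the pivots replace them. *)
Lemma stellar_regular_cover : exists c', regular_cover c' stellar.
Proof.
(* Slacks to preserve: [inl g] for column [j] over another cell, [inr (l, i)] for column [l] over
   the pivot at [i]. The next [y] is [M] times the loss. *)
pose x (y : {ffun 'I_d -> 'I_n} + 'I_n * 'I_d) := match y with
  | inl g => price a c f (col j a) - price a c g (col j a)
  | inr (l, i) => c l - price a c f (col l a) end.
pose y (y : {ffun 'I_d -> 'I_n} + 'I_n * 'I_d) : R := match y with
  | inl g => 1
  | inr (l, i) => - (lam a f (col l a) i / lam a f (col j a) i) end.
pose P (y : {ffun 'I_d -> 'I_n} + 'I_n * 'I_d) := match y with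
  | inl g => (g \in T) && ~~ (codom f \subset codom g)
  | inr (l, i) => l \notin codom f end.
have xP z : P z -> 0 < x z.
  case: z => [g /andP[gT nfg]|[l i] nl] /=; rewrite subr_gt0.
    exact: stellar_price_lt.
  by case/cellP: cf => _; apply.
have [M M0 /(_ _ (lexx M)) HM] := large_multiple y xP.
pose c' l := if l == j then price a c f (col j a) - M^-1 else c l.
have c'E g v : j \notin codom g -> price a c' g v = price a c g v.
  move=> nj; apply: price_eq => l lg; rewrite /c'; case: eqP => // e.
  by rewrite e (negPf nj) in lg.
exists c'; split=> [g /stellarP[[gT nfg]|[i ->]]|v].
- have cg : cell a c g by case: rc => + _; apply.
  have lt_g := stellar_price_lt gT nfg.
  have njg : j \notin codom g.
    apply/negP => /codomP[k ej]; move: lt_g.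
    rewrite {1}ej price_col ?(cell_unit cg) // -ej ltNge.
    by rewrite cell_le.
  apply/cellP; split=> [|l nl]; first exact: cell_unit cg.
  rewrite c'E // /c'; case: eqP => [->|_]; last by case/cellP: cg => _; apply.
  have := HM (inl g); rewrite /P gT nfg => /(_ isT) /=.
  by rewrite ltrBrDl -ltrBrDr -div1r ltr_pdivrMr // mulrC.
- apply/cellP; split=> [|l]; first exact: pivot_unit.
  move=> nl; have nlj : l != j.
    by apply: contraNneq nl => ->; apply/codomP; exists i; rewrite ffunE eqxx.
  rewrite price_pivot // !c'E // /c' eqxx (negPf nlj) [X in X * _]addrAC subrr
    add0r.
  have [/codomP[k el]|nlf] := boolP (l \in codom f).
    have eki : k = i.
      apply/eqP; apply: contraNT nl => nki; apply/codomP; exists k.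
      by rewrite ffunE (negPf nki).
    rewrite el price_col // lam_col // eki eqxx gtrDl mulNr oppr_lt0.
    by rewrite mulr_gt0 ?invr_gt0 // div1r invr_gt0.
  have := HM (inr (l, i)) nlf; rewrite /x /y.
  move: (_ / _) => r; rewrite mulrC -ltr_pdivrMr // ltrBrDl !mulNr.
  by rewrite [r / M]mulrC.
case: rc => _ cov /cov[g gT v0].
have [sfg|nfg] := boolP (codom f \subset codom g); last first.
  by exists g => //; rewrite !inE gT nfg.
have ug : basis_mx a g \in unitmx by apply: (@cell_unit _ _ _ _ c);
  case: rc => + _; apply.
have {}v0 := lam_ge0_codom uf ug (codom_sub_eq uf ug sfg) v0.
(* The ratio test needs an index; for [d = 0] column [j] would be 0. *)
have [i0 _] : exists i0 : 'I_d, true.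
  apply/existsP; rewrite -[X in is_true X]negbK negb_exists.
  apply/negP => /forallP no; have /negP[] := col_neq0 j.
  by apply/eqP/(lam_eq0 uf) => k; have := no k.
(* The least ratio selects the subcone that contains [v]. *)
case: (@arg_minP _ _ _ i0 predT
  (fun k => lam a f v k / lam a f (col j a) k) isT) => i _ mini.
exists (pivot f i j); first by apply/setUP; right; apply/imsetP; exists i.
move=> k; rewrite lam_pivot //; case: eqP => [_|_];
  first by rewrite divr_ge0 // (ltW (mu_gt0 _)).
by rewrite subr_ge0 mulrC -ler_pdivlMr // mini.
Qed.

(** New boxes lie in the old one, and [j] drops out: it is a generator of each new cell and lies in
    no other cell. *)
Lemma stellar_box_columns : (#|box_columns stellar| < #|box_columns T|)%N.
Proof.
apply: proper_card; apply/properP; split.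
  apply/subsetP => l; rewrite !inE => /exists_inP[g /stellarP[[gT _]|[i ->]]
    hg].
    by apply/exists_inP; exists g.
  apply/exists_inP; exists f => //.
  apply: half_open_pivot hg => //; exact: latt_col.
exists j; first by rewrite inE; apply/exists_inP; exists f.
rewrite inE; apply/exists_inP => -[g /stellarP[[gT nfg]|[i ->]]] hg.
  have := stellar_price_lt gT nfg; rewrite ltNge => /negP[].
  have cg : cell a c g by case: rc => + _; apply.
  apply: cell_price_le (cell_unit cg) _ => // k.
  by have /half_openP/(_ k)/andP[] := hg.
by move: hg; apply/negP; apply: half_open_pivot_new.
Qed.

Lemma stellar_good g : g \in stellar -> empty_simplex a g /\ box_in_columns a g.
Proof.
case/stellarP => [[gT _]|[i ->]]; first by split; [exact: es|exact: box].
split; first by apply: empty_simplex_pivot .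
by apply: box_in_columns_pivot .
Qed.
End Step.

Lemma unimodular_refinement c T : regular_cover c T ->
  (forall f, f \in T -> empty_simplex a f) ->
  (forall f, f \in T -> box_in_columns a f) ->
  exists c' T', regular_cover c' T' /\ forall f, f \in T' -> unimodular a f.
Proof.
have [m] := ubnP #|box_columns T|; elim: m T c => // m IHm T c lt_m rc es box.
have [b0|[j0]] := set_0Vmem (box_columns T).
  exists c, T; split=> // f fT; have uf : basis_mx a f \in unitmx.
    by apply: (@cell_unit _ _ _ _ c); case: rc => + _; apply.
  have [[j hj]|//] := unimodular_or_column aZ uf (box f fT).
  suff : j \in box_columns T by rewrite b0 inE.
  by rewrite inE; apply/exists_inP; exists f.
rewrite inE => /exists_inP[f fT hj0].
case: (@arg_minP _ _ _ j0 (fun j => half_open a f (col j a))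
  (fun j => height a f (col j a)) hj0) => j hj minj.
have [c' rc'] := stellar_regular_cover rc es box fT hj minj.
apply: (IHm _ _ _ rc') => [|g /(stellar_good rc es box fT hj minj)[]//|g].
  apply: leq_trans (stellar_box_columns rc es box fT hj minj) _.
  by rewrite -ltnS.
by case/(stellar_good rc es box fT hj minj).
Qed.
End Refinement.

Lemma full_rank_basis (R : realFieldType) d n (a : 'M[R]_(d, n)) :
  \rank a = d -> exists f : {ffun 'I_d -> 'I_n}, basis_mx a f \in unitmx.
Proof.
move=> ra; have fa : row_full a^T by rewrite /row_full mxrank_tr ra.
exists (fullrankfun fa); rewrite -unitmx_tr.
have -> : (basis_mx a (fullrankfun fa))^T = rowsub (fullrankfun fa) a^T.
  by apply/matrixP => r s; rewrite !mxE.
exact: fullrowsub_unit.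
Qed.

(** * Rounding the cost to integers *)

Section Rounding.
Variables (R : archiRealFieldType) (d n : nat) (a : 'M[R]_(d, n)).

(** Rounding down lowers a cost by less than 1 and raises a price by at most the sum of the absolute
    coordinates; scaling by [M] first makes every slack exceed both together. *)
Lemma integral_cost c (T : {set {ffun 'I_d -> 'I_n}}) : regular_cover a c T ->
  exists c' : 'I_n -> int, regular_cover a (fun j => (c' j)%:~R) T.
Proof.
case=> cells cov.
pose x (y : {ffun 'I_d -> 'I_n} * 'I_n) := c y.2 - price a c y.1 (col y.2 a).
pose y (y : {ffun 'I_d -> 'I_n} * 'I_n) : R :=
  1 + \sum_k `|lam a y.1 (col y.2 a) k|.
pose P (y : {ffun 'I_d -> 'I_n} * 'I_n) := (y.1 \in T) && (y.2 \notin codom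
  y.1).
have xP z : P z -> 0 < x z.
  case: z => f j /andP[/cells/cellP[_ H] nj]; rewrite subr_gt0; exact: H.
have [M _ /(_ _ (lexx M)) HM] := large_multiple y xP.
exists (fun j => Num.floor (M * c j)); split=> // f fT; apply/cellP.
split=> [|j nj]; first exact: cell_unit (cells f fT).
have := HM (f, j); rewrite /P /= fT nj => /(_ isT);
  rewrite /x /y /= mulrBr => gap.
have lo : M * c j - 1 < (Num.floor (M * c j))%:~R.
  by rewrite ltrBlDr; have := floorD1_gt (M * c j); rewrite intrD.
apply: le_lt_trans lo; rewrite lerBrDl.
apply: le_trans (_ : 1 + (M * price a c f (col j a) +
    \sum_k `|lam a f (col j a) k|) <= _); last by lra.
rewrite lerD2l /price mulr_sumr -big_split /=; apply: ler_sum => k _.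
set l := lam _ _ _ _; rewrite -lerBlDl mulrA -mulrBl.
apply: le_trans (ler_norm _) _; rewrite normrM ler_piMl //.
rewrite ler_norml; have /andP[f0 f1] := floor_itv (M * c (f k)).
by move: f1; rewrite intrD; lra.
Qed.
End Rounding.

(** * An integral cost with a unimodular cover *)

Section Existence.
Variables (d n : nat) (A : 'M[int]_(d, n)).
Local Notation a := (AR A).

Lemma AR_int r j : a r j \is a (@Num.int RR).
Proof. by rewrite mxE intr_int. Qed.

Lemma kernel_sum : kernel_pos_trivial A -> forall x : 'I_n -> RR,
  (forall j, 0 <= x j) -> \sum_j x j *: col j a = 0 -> forall j, x j = 0.
Proof.
move=> ker x x0 e j; have /matrixP/(_ j 0) : (\col_j x j) = 0.
  apply: ker => [l|]; first by rewrite mxE.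
  by rewrite mulmx_sum_col -[RHS]e; apply: eq_bigr => l _; rewrite mxE.
by rewrite !mxE.
Qed.

Lemma kernel_col_neq0 : kernel_pos_trivial A -> forall j, col j a != 0.
Proof.
move=> /kernel_sum ker j; apply/eqP => e.
have /eqP : (fun l => (l == j)%:R : RR) j = 0.
  apply: (ker (fun l => (l == j)%:R)) => [l|]; first exact: ler0n.
  rewrite (bigD1 j) //= e scaler0 add0r big1 // => l /negPf->.
  by rewrite scale0r.
by rewrite /= eqxx oner_eq0.
Qed.

Lemma nonneg_combP v : nonneg_comb a v <-> in_cone A v.
Proof.
split=> [[x x0 ev]|[x [x0 [_ ev]]]].
  exists (\col_j x j); split=> [j|]; first by rewrite mxE.
  split=> [j|]; first by rewrite inE.
  by rewrite mulmx_sum_col -ev; apply: eq_bigr => j _; rewrite mxE.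
by exists (fun j => x j 0) => //; rewrite -mulmx_sum_col.
Qed.

Lemma normal_nat : normal A -> forall v : 'cV[RR]_d,
  latt v -> nonneg_comb a v ->
  exists u : 'I_n -> nat, v = \sum_j (u j)%:R *: col j a.
Proof.
move=> nA v vZ /nonneg_combP cv.
pose b := \col_r Num.floor (v r 0).
have eb : map_mx (fun z : int => z%:~R) b = v.
  apply/matrixP => r s; rewrite !mxE (ord1 s).
  by have /intrP[m ->] := vZ r; rewrite intrKfloor.
rewrite -eb in cv; have [u [u0 Au]] := (nA b).2 cv.
exists (fun j => absz (u j 0)); rewrite -eb -Au.
rewrite -[map_mx _ _]/(map_mx intr _) map_mxM mulmx_sum_col.
apply: eq_bigr => j _; congr (_ *: _).
by rewrite mxE -[in LHS](gez0_abs (u0 j)).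
Qed.

Lemma exists_unimodular_cover : standing_assumptions A -> normal A ->
  (d <= 3)%N ->
  exists (c : 'rV[int]_n) T, regular_cover a (fun j => (c 0 j)%:~R) T /\
    forall f, f \in T -> unimodular a f.
Proof.
case=> rkA _ kerA _ nA d3.
have [f0 uf0] := full_rank_basis rkA.
have [v [v0 nondeg]] := nondegenerate_point uf0.
have [c [sc Hc]] := lexicographic_cost a (fun l => \sum_r a r l ^+ 2).
have [f1 cf1] := primal_simplex sc (kernel_sum kerA) nondeg uf0 v0.
have rc : regular_cover a c [set f | cell a c f].
  split=> [f|w /(dual_simplex sc cf1)[f cf w0]]; first by rewrite inE.
  by exists f => //; rewrite inE.
have es f : f \in [set f | cell a c f] -> empty_simplex a f.
  rewrite inE => cf; apply: empty_simplex_init (cell_unit cf) _ _.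
  - exact: normal_nat.
  - by move=> j; case: (Hc f cf j).
  - by move=> j; case: (Hc f cf j).
have box f : f \in [set f | cell a c f] -> box_in_columns a f.
  move=> fT; move: (fT); rewrite inE => cf.
  apply: box_in_columns_init (es f fT) => //.
  - exact: AR_int.
  - exact: normal_nat.
  - exact: cell_unit cf.
  - by move=> j; case: (Hc f cf j).
have [c' [T [rc' uT]]] :=
  unimodular_refinement AR_int d3 (kernel_col_neq0 kerA) rc es box.
have [c'' rc''] := integral_cost rc'.
exists (\row_j c'' j), T; split=> //.
have e : (fun j => ((\row_j c'' j) 0 j)%:~R) =1 (fun j => (c'' j)%:~R : RR).
  by move=> j; rewrite mxE.
case: rc'' => cells cov; split=> // f /cells/cellP[uf H]; apply/cellP.
split=> // j nj; have /= := e j; rewrite /= => ->.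
by rewrite (price_eq _ _ (fun l _ => e l)) H.
Qed.
End Existence.

(** * Integer programs over a unimodular triangulation *)

Section SameCodom.
Variables (R : realFieldType) (d n : nat) (a : 'M[R]_(d, n)).
Variables (f g : {ffun 'I_d -> 'I_n}).
Hypotheses (uf : basis_mx a f \in unitmx) (gi : injective g).
Hypothesis sub_gf : codom g \subset codom f.

Lemma basis_mx_unit_codom : basis_mx a g \in unitmx.
Proof.
rewrite unitmxE unitfE -det_tr; apply/det0P => -[w nz /(congr1 trmx)].
rewrite trmx_mul trmxK trmx0 mul_basis_mx => e; case/eqP: nz; apply/rowP => l.
have /codomP[k ek] := subsetP sub_gf _ (codom_f g l).
have := lam0 a f k; rewrite -e lam_sum (bigD1 l) //= ek lam_col // eqxx mulr1.
rewrite big1 ?addr0 => [|m nml]; first by rewrite !mxE.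
have /codomP[k' ek'] := subsetP sub_gf _ (codom_f g m).
rewrite ek' lam_col //; case: eqP => [ekk|_]; last by rewrite mulr0.
by move: nml; rewrite -(inj_eq gi) ek ek' ekk eqxx.
Qed.

(** [dual_sol] lists a face in increasing order, a cell in any order; the dual functional depends on
    the set alone. *)
Lemma price_codom c v : price a c f v = price a c g v.
Proof.
rewrite -{1}(lamK v basis_mx_unit_codom) price_sum; apply: eq_bigr => k _.
have /codomP[l el] := subsetP sub_gf _ (codom_f g k).
by rewrite el price_col // mulrC.
Qed.
End SameCodom.

Section GomoryFromUnimodular.
Variables (d n : nat) (A : 'M[int]_(d, n)) (c : 'rV[int]_n).
Variable T : {set {ffun 'I_d -> 'I_n}}.
Local Notation a := (AR A).
Local Notation cc := (fun j => (c 0 j)%:~R : RR).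
Hypothesis rc : regular_cover a cc T.
Hypothesis uni : forall f, f \in T -> unimodular a f.
Implicit Types (f g : {ffun 'I_d -> 'I_n}) (x : 'cV[RR]_n) (j : 'I_n).

Definition face f : {set 'I_n} := [set j in codom f].

Lemma mem_face f j : (j \in face f) = (j \in codom f).
Proof. by rewrite inE. Qed.

Lemma T_cell f : f \in T -> cell a cc f.
Proof. by case: rc => + _; apply. Qed.

Lemma T_unit f : f \in T -> basis_mx a f \in unitmx.
Proof. by move=> /T_cell/cell_unit. Qed.

Lemma card_face f : f \in T -> #|face f| = d.
Proof. by move=> /T_unit/basis_mx_inj fi;
  rewrite cardsE card_codom // card_ord. Qed.

(** The condition in [in_Delta] with its witness exposed. *)
Definition tight (s : {set 'I_n}) (y : 'rV[RR]_d) : Prop := forall j,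
  (j \in s -> (y *m col j a) 0 0 = cR c 0 j) /\
  (j \notin s -> (y *m col j a) 0 0 < cR c 0 j).

Lemma tight_le s y j : tight s y -> (y *m col j a) 0 0 <= cR c 0 j.
Proof.
by move=> /(_ j)[H1 H2]; case: (boolP (j \in s)) => [/H1->|/H2/ltW].
Qed.

Definition multiplier (w : 'I_n -> RR) f : 'rV[RR]_d :=
  (\row_k w (f k)) *m invmx (basis_mx a f).

Lemma multiplierE w f v : (multiplier w f *m v) 0 0 = price a w f v.
Proof. by rewrite -mulmxA mxE; apply: eq_bigr => k _; rewrite mxE. Qed.

Lemma tight_cell f : f \in T -> tight (face f) (multiplier cc f).
Proof.
move=> fT j; have /cellP[uf H] := T_cell fT; rewrite mem_face multiplierE mxE.
by split=> [/codomP[k ->]|/H//]; rewrite price_col.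
Qed.

(** By duality [x] and [x'] both have least cost, so the slacks of [y], positive off [s], sum to 0
    against [x']. *)
Lemma complementary_slackness s y x (t : {set 'I_n}) z x' :
  tight s y -> tight t z -> (forall j, 0 <= x j 0) -> (forall j, 0 <= x' j 0) ->
  (forall j, j \notin s -> x j 0 = 0) -> (forall j, j \notin t -> x' j 0 = 0) ->
  a *m x = a *m x' -> forall j, j \notin s -> x' j 0 = 0.
Proof.
move=> ty tz x0 x'0 sx sx' e j nj.
have eqy (s1 : {set 'I_n}) y1 x1 : tight s1 y1 -> (forall j, j \notin s1 -> x1
  j 0 = 0) ->
    (y1 *m (a *m x1)) 0 0 = \sum_j x1 j 0 * cR c 0 j.
  move=> t1 s1x; rewrite mul_row_cols; apply: eq_bigr => l _.
  have [/(t1 l).1->//|/s1x->] := boolP (l \in s1); by rewrite !mul0r.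
have ley (s1 : {set 'I_n}) y1 x1 : tight s1 y1 -> (forall j, 0 <= x1 j 0) ->
    (y1 *m (a *m x1)) 0 0 <= \sum_j x1 j 0 * cR c 0 j.
  move=> t1 x10; rewrite mul_row_cols; apply: ler_sum => l _.
  by rewrite ler_wpM2l // (tight_le _ t1).
have le1 : \sum_j x' j 0 * cR c 0 j <= \sum_j x j 0 * cR c 0 j.
  by rewrite -(eqy _ _ _ tz sx') -e (ley _ _ _ tz x0).
have gap0 l : true -> 0 <= x' l 0 * (cR c 0 l - (y *m col l a) 0 0).
  by move=> _; rewrite mulr_ge0 // subr_ge0 (tight_le _ ty).
have : \sum_l x' l 0 * (cR c 0 l - (y *m col l a) 0 0) = 0.
  apply/eqP; rewrite eq_le sumr_ge0 // andbT.
  under eq_bigr do rewrite mulrBr.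
  by rewrite sumrB -mul_row_cols -e (eqy _ _ _ ty sx) subr_le0.
move/(psumr_eq0P gap0)/(_ j isT)/eqP; rewrite mulf_eq0 subr_eq0.
by case/orP => [/eqP//|/eqP eqj]; have := (ty j).2 nj; rewrite eqj ltxx.
Qed.

Lemma spread_cone f (w : 'I_d -> RR) : (forall k, 0 <= w k) ->
  in_cone_sub A (face f) (\sum_k w k *: col (f k) a).
Proof.
move=> w0; exists (spread f w); split; last split.
- by move=> j; apply: spread_ge0.
- by move=> j; rewrite mem_face; apply: spread_notin.
- exact: mulmx_spread.
Qed.

(** The sum of the columns in [s] lies in some cell, and complementary slackness applied to the
    indicator of [s] puts [s] inside that cell. *)
Lemma Delta_sub_face s : in_Delta A c s -> exists2 f, f \in T & s \subset face
  f.
Proof.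
case=> y ty; pose x : 'cV[RR]_n := \col_j (j \in s)%:R.
have x0 j : 0 <= x j 0 by rewrite mxE ler0n.
have xs j : j \notin s -> x j 0 = 0 by move=> /negPf nj; rewrite mxE nj.
have [|f fT v0] := rc.2 (a *m x).
  by exists (fun j => x j 0) => //; rewrite -mulmx_sum_col.
exists f => //; have uf := T_unit fT.
apply/subsetP => j js; apply: contraLR isT => nj.
have [x' [x'0 [sx' ex']]] := spread_cone f v0.
rewrite lamK // in ex'.
have := complementary_slackness (tight_cell fT) ty x'0 x0 sx' xs ex' nj.
by move/eqP; rewrite mxE js oner_eq0.
Qed.

Lemma unimodular_triangulation : triangulation A (in_Delta A c).
Proof.
split.
- move=> s /Delta_sub_face[f fT sf] x sx e; have uf := T_unit fT.
  have xf j : j \notin codom f -> x j 0 = 0.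
    by move=> nj; apply: sx; apply: contraNN nj => /(subsetP sf);
      rewrite mem_face.
  have lx k : x (f k) 0 = 0.
    rewrite -(lam0 a f k); symmetry; move: k.
    apply: (lam_uniq (w := fun k => x (f k) 0) uf).
    rewrite -[RHS]e mulmx_sum_col; symmetry.
    apply: (@sum_codom _ _ _ f (fun j => x j 0 *: col j a));
      first exact: basis_mx_inj uf.
    by move=> j /xf->; rewrite scale0r.
  apply/matrixP => j l; rewrite (ord1 l) mxE.
  by have [/codomP[k ->]|/xf//] := boolP (j \in codom f).
- move=> s t Ds ts; have [f fT sf] := Delta_sub_face Ds.
  have uf := T_unit fT; case: Ds => y ty.
  (* To untighten [s :\: t], move [y] slightly along a [z] equal to -1 there and 0 on [t]; it exists
     because [s] is part of a basis. *)
  pose w j : RR := - (j \in s :\: t)%:R.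
  pose z := multiplier w f.
  have zE j : j \in s -> (z *m col j a) 0 0 = w j.
    by move=> /(subsetP sf); rewrite mem_face multiplierE => /codomP[k ->];
      rewrite price_col.
  have [M M0 /(_ _ (lexx M)) HM] := @large_multiple _ _ (fun j => j \notin s)
    (fun j => cR c 0 j - (y *m col j a) 0 0) (fun j => (z *m col j a) 0 0)
    (fun j nj => etrans (subr_gt0 _ _) ((ty j).2 nj)).
  exists (y + M^-1 *: z) => j.
  have -> : ((y + M^-1 *: z) *m col j a) 0 0 =
      (y *m col j a) 0 0 + M^-1 * (z *m col j a) 0 0.
    by rewrite mulmxDl -scalemxAl !mxE.
  split=> [jt|njt].
    have js := subsetP ts _ jt.
    by rewrite zE // (ty j).1 // /w inE jt oppr0 mulr0 addr0.
  have [js|njs] := boolP (j \in s).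
    rewrite zE // (ty j).1 // /w inE njt js /= gtrDl mulrN1 oppr_lt0.
    by rewrite invr_gt0.
  by have := HM j njs; rewrite -ltr_pdivrMl // ltrBrDl.
- move=> v /nonneg_combP/(rc.2)[f fT v0]; exists (face f).
    by exists (multiplier cc f); apply: tight_cell.
  by rewrite -(lamK v (T_unit fT)); apply: spread_cone.
move=> s t [y ty] [z tz] v [x [x0 [xs ex]]] [x' [x'0 [xs' ex']]].
exists x'; split=> //; split=> // j; rewrite inE negb_and.
case/orP => [njs|/xs'//]; rewrite -ex' in ex.
exact: (complementary_slackness ty tz x0 x'0 xs xs' ex njs).
Qed.

Lemma face_maximal f : f \in T -> maximal_face A c (face f).
Proof.
move=> fT; split; first by exists (multiplier cc f); apply: tight_cell.
move=> s /Delta_sub_face[g gT sg] fs; apply/eqP.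
rewrite eq_sym eqEcard fs (card_face fT) -(card_face gT).
exact: subset_leq_card.
Qed.

Lemma dual_solE f v : f \in T ->
  (dual_sol A c (face f) *m v) 0 0 = price a cc f v.
Proof.
move=> fT; have E := card_face fT; have uf := T_unit fT.
(* The increasing enumeration of the face, as in [A_sub] and [c_sub]. *)
pose g : {ffun 'I_d -> 'I_n} :=
  [ffun k => @enum_val _ (mem (face f)) (cast_ord (esym E) k)].
have gi : injective g.
  by move=> k l; rewrite !ffunE => /enum_val_inj/cast_ord_inj.
have sgf : codom g \subset codom f.
  apply/subsetP => _ /codomP[k ->]; rewrite -mem_face ffunE; exact: enum_valP.
rewrite (price_codom uf gi sgf) -multiplierE /dual_sol /multiplier.
congr ((_ *m invmx _ *m v) 0 0).
  rewrite (conform_row E (fun k => cR c 0 (enum_val k))).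
  by apply/rowP => k; rewrite !mxE ffunE.
rewrite /A_sub (conform_colsub a E (fun k => enum_val k)).
by apply/matrixP => r s; rewrite !mxE ffunE.
Qed.

Section Program.
Variables (b : 'cV[int]_d) (f : {ffun 'I_d -> 'I_n}).
Local Notation v := (map_mx (fun z : int => z%:~R : RR) b).
Hypotheses (fT : f \in T) (v0 : forall k, 0 <= lam a f v k).

(** By unimodularity the floor changes no value; it only produces entries of type [int]. *)
Definition basic_solution : 'cV[int]_n := spread f (fun k =>
  Num.floor (lam a f v k)).
Local Notation x0 := basic_solution.

Lemma basic_ge0 j : 0 <= x0 j 0.
Proof. by apply: spread_ge0 => k; rewrite floor_ge0. Qed.

Lemma floor_lam k : (Num.floor (lam a f v k))%:~R = lam a f v k.
Proof. by apply: floorK; apply: uni => // r; rewrite mxE intr_int. Qed.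

Lemma basic_feasible : A *m x0 = b.
Proof.
apply/matrixP => r s; apply: (@intr_inj RR); rewrite (ord1 s).
transitivity (v r 0); last by rewrite mxE.
rewrite -(lamK v (T_unit fT)) mulmx_spread !summxE rmorph_sum.
by apply: eq_bigr => k _; rewrite !mxE rmorphM /= floor_lam.
Qed.

Lemma feasible_sum (x : 'cV[int]_n) : A *m x = b -> \sum_j (x j 0)%:~R *:
  col j a = v.
Proof.
move=> <-; rewrite -[RHS]/(map_mx intr _) map_mxM mulmx_sum_col.
by apply: eq_bigr => j _; rewrite mxE.
Qed.

Lemma feasible_cost (x : 'cV[int]_n) : A *m x = b -> cost c x =
  price a cc f v + \sum_j (cc j - price a cc f (col j a)) * (x j 0)%:~R.
Proof.
move=> /feasible_sum ev; rewrite -ev price_sum -big_split /= /cost mxE.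
by apply: eq_bigr => j _; rewrite !mxE; ring.
Qed.

Lemma basic_slack j :
  (cc j - price a cc f (col j a)) * (x0 j 0)%:~R = 0.
Proof.
have [/codomP[k ->]|nj] := boolP (j \in codom f).
  by rewrite price_col ?T_unit // subrr mul0r.
by rewrite spread_notin // mulr0.
Qed.

Lemma basic_cost : cost c x0 = price a cc f v.
Proof.
rewrite feasible_cost ?basic_feasible // big1 ?addr0 // => j _.
exact: basic_slack.
Qed.

Lemma reduced_ge0 j : 0 <= cc j - price a cc f (col j a).
Proof. by rewrite subr_ge0; apply: cell_le; apply: T_cell. Qed.

Lemma basic_unique_optimum : unique_optimum A c b.
Proof.
have terms0 (x : 'cV[int]_n) : (forall j, 0 <= x j 0) -> forall j, true ->
    0 <= (cc j - price a cc f (col j a)) * (x j 0)%:~R.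
  by move=> x_0 j _; rewrite mulr_ge0 ?reduced_ge0 // ler0z.
exists x0; split.
  split; first by split; [exact: basic_ge0|exact: basic_feasible].
  move=> x [x_0 ex]; rewrite basic_cost feasible_cost // lerDl.
  by rewrite sumr_ge0 // => j _; apply: terms0.
move=> x [[x_0 ex] /(_ x0 (conj basic_ge0 basic_feasible))].
rewrite basic_cost feasible_cost // gerDl => le0.
have {}le0 : \sum_j (cc j - price a cc f (col j a)) * (x j 0)%:~R = 0.
  by apply/eqP; rewrite eq_le le0 sumr_ge0 // => j _; apply: terms0.
(* Reduced costs off the cell are positive, so every optimum is supported on the cell, where the
   equations have one solution. *)
have xf j : j \notin codom f -> x j 0 = 0.
  move=> nj; have /(_ j isT)/eqP := psumr_eq0P (terms0 x x_0) le0.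
  rewrite mulf_eq0 intr_eq0 subr_eq0 => /orP[/eqP e|/eqP//].
  by have /cellP[_ /(_ j nj)] := T_cell fT; rewrite -e ltxx.
have uf := T_unit fT; have fi := basis_mx_inj uf.
have lx : forall k, lam a f v k = (x (f k) 0)%:~R.
  apply: lam_uniq => //; rewrite -[RHS](feasible_sum ex); symmetry.
  apply: (@sum_codom _ _ _ f (fun j => (x j 0)%:~R *: col j a)) => // j /xf->.
  by rewrite scale0r.
apply/matrixP => j l; rewrite (ord1 l).
have [/codomP[k ->]|nj] := boolP (j \in codom f); last first.
  by rewrite xf // spread_notin.
by rewrite spread_at // lx intrKfloor.
Qed.

Lemma basic_group_solves : group_solves A c (face f) b.
Proof.
exists x0; split; last exact: basic_ge0.
have red j : red_cost A c (face f) j = cc j - price a cc f (col j a).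
  by rewrite /red_cost dual_solE // mxE.
split; first by split; [move=> j _; exact: basic_ge0|exact: basic_feasible].
move=> x [x_0 _]; rewrite /group_obj big1 => [|j _]; last first.
  by rewrite red basic_slack.
by apply: sumr_ge0 => j; rewrite inE => /x_0 xj;
  rewrite red mulr_ge0 ?reduced_ge0 ?ler0z.
Qed.
End Program.

Lemma NA_covered b : in_NA A b -> exists2 f, f \in T &
  forall k, 0 <= lam a f (map_mx (fun z : int => z%:~R : RR) b) k.
Proof.
case=> u [u0 e]; apply: rc.2; exists (fun j => (u j 0)%:~R).
  by move=> j; rewrite ler0z.
exact: feasible_sum.
Qed.

Lemma unimodular_generic : generic A c.
Proof.
split; first exact: unimodular_triangulation.
by move=> b /NA_covered[f fT v0]; apply: basic_unique_optimum v0.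
Qed.

Lemma unimodular_gomory : gomory_family A c.
Proof.
move=> b /NA_covered[f fT v0]; exists (face f); split.
  exact: face_maximal.
exact: basic_group_solves.
Qed.
End GomoryFromUnimodular.

Theorem theorem5p2 (d n : nat) (A : 'M[int]_(d, n)) :
  standing_assumptions A -> normal A -> (d <= 3)%N ->
  exists c : 'rV[int]_n, generic A c /\ gomory_family A c.
Proof.
move=> sA nA d3; have [c [T [rc uni]]] := exists_unimodular_cover sA nA d3.
exists c; split; first exact: unimodular_generic rc uni.
exact: unimodular_gomory rc uni.
Qed.
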